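(* There is a compact set $A \subseteq \mathbb{R}$ with $0 < \dim_P(A) < 1$ (so that $A$ is nowhere dense and its packing dimension exceeds its topological dimension $0$) such that $(\mathcal{M}_{\mathbb{R}}, A)$ avoids a compact set.
   Context: $\dim_P$ denotes packing dimension. $\mathcal{M}_{\mathbb{R}}$ is the first-order structure expanding $(\mathbb{R},<,+)$ by all functions $\mathbb{R} \to \mathbb{R}$, $x \mapsto \lambda x$, for $\lambda \in \mathbb{R}$, and $(\mathcal{M}_{\mathbb{R}},A)$ is its expansion by a predicate for $A$. An expansion of $(\mathbb{R},<,+)$ avoids a compact set if for some $n$ there is a compact subset of $\mathbb{R}^n$ that is not definable in it (with parameters). *)

(* Defs.v *)
From HB Require Import structures.
From mathcomp Require Import all_boot all_order all_algebra.
From mathcomp Require Import all_classical all_reals all_analysis.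

Set Implicit Arguments.
Unset Strict Implicit.
Unset Printing Implicit Defensive.

Import Order.TTheory GRing.Theory Num.Theory.
Import numFieldNormedType.Exports.

Local Open Scope classical_set_scope.
Local Open Scope ring_scope.

Record language := Language {
  fsym : Type;
  farity : fsym -> nat;
  rsym : Type;
  rarity : rsym -> nat }.

Record structure (L : language) (M : Type) := Structure {
  finterp : forall f : fsym L, ('I_(farity f) -> M) -> M;
  rinterp : forall r : rsym L, ('I_(rarity r) -> M) -> Prop }.

Section Syntax.
Variable L : language.

Inductive term (n : nat) : Type :=
| Var of 'I_n
| App (f : fsym L) of ('I_(farity f) -> term n).

(* [formula n]: the free variables are among n variables. Variables are
   de Bruijn indices: [Ex] binds the variable of index 0. *)
Inductive formula : nat -> Type :=
| Eq n of term n & term n : formula n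
| Rel n (r : rsym L) of ('I_(rarity r) -> term n) : formula n
| Not n of formula n : formula n
| And n of formula n & formula n : formula n
| Ex n of formula n.+1 : formula n.

Variables (M : Type) (S : structure L M).

Fixpoint eval n (v : 'I_n -> M) (t : term n) : M :=
  match t with
  | Var i => v i
  | App f args => finterp S (fun j => eval v (args j))
  end.

Definition push n (a : M) (v : 'I_n -> M) (i : 'I_n.+1) : M :=
  if unlift ord0 i is Some j then v j else a.

Fixpoint holds n (phi : formula n) : ('I_n -> M) -> Prop :=
  match phi in formula n return ('I_n -> M) -> Prop with
  | Eq _ t u => fun v => eval v t = eval v u
  | Rel _ r args => fun v => rinterp S (fun j => eval v (args j))
  | Not _ p => fun v => ~ holds p v
  | And _ p q => fun v => holds p v /\ holds q v
  | Ex _ p => fun v => exists a, holds p (push a v)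
  end.

(* Definability with parameters: the last k variables of [phi] are
   instantiated by the parameters [b]. *)
Definition definable n (X : set 'rV[M]_n) : Prop :=
  exists k (phi : formula (n + k)) (b : 'rV[M]_k),
    forall x : 'rV[M]_n, X x <-> holds phi (fun i => row_mx x b ord0 i).

End Syntax.

Definition pred_language (L : language) : language :=
  {| fsym := fsym L;
     farity := @farity L;
     rsym := option (rsym L);
     rarity := fun r => if r is Some r' then rarity r' else 1 |}.

Definition expand_pred (L : language) (M : Type) (S : structure L M) (A : set M) :
    structure (pred_language L) M :=
  @Structure (pred_language L) M
    (fun f => @finterp L M S f)
    (fun r => match r return
          ('I_(@rarity (pred_language L) r) -> M) -> Prop with
        | Some r' => fun v => rinterp S v
        | None => fun v => A (v ord0)
        end).

Inductive vs_fsym (R : Type) := VAdd | VScale of R.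
Inductive vs_rsym := VLt.

Definition vs_language (R : Type) : language :=
  {| fsym := vs_fsym R;
     farity := fun f => match f with VAdd => 2 | VScale _ => 1 end;
     rsym := vs_rsym;
     rarity := fun _ => 2 |}.

Definition ordered_vs (R : realType) : structure (vs_language R) R :=
  @Structure (vs_language R) R
    (fun f => match f return ('I_(@farity (vs_language R) f) -> R) -> R with
        | VAdd => fun v => v ord0 + v ord_max
        | VScale lambda => fun v => lambda * v ord0
        end)
    (fun r v => v ord0 < v ord_max).

Definition avoids_compact_set (R : realType) (L : language)
    (S : structure L R) : Prop :=
  exists n (K : set 'rV[R]_n), compact K /\ ~ definable S K.

Section Packing.
Variable R : realType.
Implicit Types (E : set R) (s delta : R) (P : set (R * R)).

(* P is the set of pairs (centre, radius) of a family of pairwise disjoint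
   closed balls. *)
Definition packing delta E P : Prop :=
  [/\ countable P,
      (forall p, P p -> E p.1 /\ 0 < p.2 <= delta) &
      trivIset P (fun p => closed_ball p.1 p.2)].

Local Open Scope ereal_scope.

(* 2 * p.2 is the diameter of the ball. *)
Definition packing_sup s delta E : \bar R :=
  ereal_sup [set \esum_(p in P) ((2 * p.2) `^ s)%:E | P in packing delta E].

(* [packing_sup s delta E] is nondecreasing in delta, so this infimum is its
   limit as delta tends to 0. *)
Definition packing_premeasure s E : \bar R :=
  ereal_inf [set packing_sup s delta E | delta in [set d : R | (0 < d)%R]].

Definition packing_measure s E : \bar R :=
  ereal_inf [set \sum_(0 <= i <oo) packing_premeasure s (F i)
            | F in [set F : (set R)^nat | E `<=` \bigcup_i F i]].

Definition packing_dim E : \bar R :=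
  ereal_inf [set s%:E | s in
    [set s : R | (0 <= s)%R /\ packing_measure s E = 0]].

End Packing.

Definition nowhere_dense (T : topologicalType) (X : set T) : Prop :=
  interior (closure X) = set0.

(* The small inductive dimension of the subspace X is less than n. A relatively
   open V in X has boundary [X `&` closure V `&` closure (X `\` V)] in X. *)
Fixpoint ind_lt (T : topologicalType) (n : nat) (X : set T) : Prop :=
  if n is m.+1 then
    forall x (U : set T), X x -> open U -> U x ->
      exists O : set T, [/\ open O, O x, X `&` O `<=` U &
        ind_lt m (X `&` closure (X `&` O) `&` closure (X `\` O))]
  else X = set0.

Definition topological_dim (T : topologicalType) (X : set T) (n : nat) : Prop :=
  ind_lt n.+1 X /\ ~ ind_lt n X.

(* Main.v *)
Require Import Defs.
From mathcomp Require Import all_boot all_order all_algebra.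
From mathcomp Require Import all_classical all_reals all_analysis.
From mathcomp Require Import ring lra zify.
Import Order.TTheory GRing.Theory Num.Theory.
Import numFieldNormedType.Exports.
Set Implicit Arguments.
Unset Strict Implicit.
Unset Printing Implicit Defensive.
Local Open Scope classical_set_scope.

(** Two independent ideas are combined.

    Definability. Let A be compact. A formula over the ordered vector space
    with a predicate for A can be rewritten so that its quantifiers range over
    A only, because the truth of a condition on y that is built from affine
    comparisons with parameters in A depends only on the cut that y makes in
    the compact set D of all values to which y is compared. If y lies in D, it
    is an affine image of a point of a power of A. Otherwise the neighbours of
    y in D exist by compactness, and any point between them serves as well as
    y. This is carried out semantically: a set is [sign_determined] when
    membership depends only on the signs of finitely many families of affine
    forms c . v + t, where t ranges over a compact set T. Such sets are stable
    under projection by Fourier-Motzkin elimination ([sign_determined_ex]),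
    which replaces the families T by sets l T + m T', so every definable set is
    [sign_determined] with sets T built from A by such linear combinations
    ([sign_determined_holds]). If no such T contains an interval, a definable
    subset of the line is constant on some subinterval of every interval
    ([sign_determined_constant]). Then the compact plane set made of the
    segment {0} x [0, 1] and of the points (2^-n, q_n), where q enumerates the
    rationals of [0, 1], is not definable: the projection of its part off the
    segment is dense and countable.

    Geometry. The set A consists of the sums of w_k 4^(-s k) over all sequences
    w of zeros and ones. The exponents s oscillate between two regimes. At
    infinitely many levels n, s n exceeds any given multiple of n, so 2^n balls
    of radius 4^(-s n) cover A, and every linear combination of copies of A has
    a cover by 2^(p n) balls of comparable radius, too few to fill an interval
    ([thin_no_interval]). At infinitely many other levels s n <= 2 n + 1, where
    A has 2^n pieces that are separated by about 16^(-n); with Baire's argument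
    this bounds the packing dimension from below by 1/8 ([packing_dim_ge]). As
    s n >= n throughout, a ball of radius about 4^(-n) centred in A contains a
    whole piece of level n, and the Kraft inequality for the words that label
    these pieces bounds the packing dimension from above by 3/4
    ([packing_dim_le]). *)

(** * Definable sets are determined by signs of affine forms *)

Section SignDetermined.
Local Open Scope ring_scope.
Variable R : realType.

Definition dot n (c v : 'I_n -> R) : R := \sum_i c i * v i.

Lemma dot_push n (c : 'I_n.+1 -> R) y (v : 'I_n -> R) :
  dot c (push y v) = c ord0 * y + dot (fun i => c (lift ord0 i)) v.
Proof.
rewrite /dot big_ord_recl /push unlift_none; congr (_ + _).
by apply: eq_bigr => i _; rewrite liftK.
Qed.

Lemma dotB n (c d v : 'I_n -> R) : dot (fun i => c i - d i) v = dot c v - dot d v.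
Proof. by rewrite /dot -sumrB; apply: eq_bigr => i _; rewrite mulrBl. Qed.

Lemma dotZ n a (c v : 'I_n -> R) : dot (fun i => a * c i) v = a * dot c v.
Proof. by rewrite /dot mulr_sumr; apply: eq_bigr => i _; rewrite mulrA. Qed.

Lemma eval_dot (A : set R) n (t : term (pred_language (vs_language R)) n) :
  exists c, forall v, Defs.eval (expand_pred (ordered_vs R) A) v t = dot c v.
Proof.
elim: t => [i|[|a] args IH].
- exists (fun j => (j == i)%:R) => v.
  rewrite /dot (bigD1 i)//= eqxx mul1r big1 ?addr0// => j /negbTE ->.
  by rewrite mul0r.
- have [c cE] := IH ord0; have [d dE] := IH ord_max.
  exists (fun i => c i + d i) => v /=.
  by rewrite cE dE /dot -big_split; apply: eq_bigr => i _; rewrite mulrDl.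
- have [c cE] := IH ord0.
  by exists (fun i => a * c i) => v /=; rewrite cE dotZ.
Qed.

(** Compactness provides a largest point of L and a smallest point of U; their
    midpoint separates the two sets even when these are infinite. *)
Lemma separating_point (L U : set R) : compact L -> compact U ->
  (forall l u, L l -> U u -> l < u) ->
  exists y, (forall l, L l -> l < y) /\ (forall u, U u -> y < u).
Proof.
move=> cL cU LU.
have topL : L !=set0 -> exists2 m, L m & forall l, L l -> l <= m.
  move=> L0; have [|m /set_mem Lm ub] := @compact_EVT_max _ _ (@idfun R) L L0 cL.
    by apply: continuous_subspaceT => x; exact: cvg_id.
  by exists m => // l Ll; apply: ub; apply/mem_set.
have botU : U !=set0 -> exists2 m, U m & forall u, U u -> m <= u.
  move=> U0; have [|m /set_mem Um ub] := @compact_EVT_min _ _ (@idfun R) U U0 cU.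
    by apply: continuous_subspaceT => x; exact: cvg_id.
  by exists m => // l Ll; apply: ub; apply/mem_set.
have [->|/set0P L0] := eqVneq L set0.
  have [->|/set0P U0] := eqVneq U set0; first by exists 0; split.
  have [m _ mP] := botU U0; exists (m - 1); split => // u /mP; lra.
have [m Lm mP] := topL L0.
have [->|/set0P U0] := eqVneq U set0.
  exists (m + 1); split => // l /mP; lra.
have [m' Um' mP'] := botU U0; have := LU _ _ Lm Um' => ?.
exists ((m + m') / 2); split => [l /mP|u /mP']; lra.
Qed.

(* The intended instance is the class of linear combinations of copies of the
   predicate A. The set T of constants below plays the role of bounded
   quantifiers over A. *)
Variable small : set R -> Prop.

(** The condition relating v and v' is symmetric, so membership in X is a
    function of the signs. Nothing is asked of that function, which makes
    Boolean combinations immediate. *)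
Definition sign_determined n (X : ('I_n -> R) -> Prop) : Prop :=
  exists (I : finType) (c : I -> 'I_n -> R) (T : I -> set R),
    (forall i, small (T i)) /\
    forall v v', (forall i t, T i t ->
        Num.sg (dot (c i) v + t) = Num.sg (dot (c i) v' + t)) ->
      X v -> X v'.

Hypothesis small0 : small [set 0].
Hypothesis small_comb : forall T T' l m, small T -> small T' ->
  small [set l * t.1 + m * t.2 | t in T `*` T'].
Hypothesis small_compact : forall T, small T -> compact T.

Lemma sign_determined_not n (X : ('I_n -> R) -> Prop) :
  sign_determined X -> sign_determined (fun v => ~ X v).
Proof.
move=> [I [c [T [sT XP]]]]; exists I, c, T; split => // v v' vv' nX X'.
by apply/nX/(XP v') => // i t Tt; rewrite vv'.
Qed.

Lemma sign_determined_and n (X Y : ('I_n -> R) -> Prop) :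
  sign_determined X -> sign_determined Y ->
  sign_determined (fun v => X v /\ Y v).
Proof.
move=> [I [c [T [sT XP]]]] [J [d [S [sS YP]]]].
exists (I + J)%type, (fun k => match k with inl i => c i | inr j => d j end),
  (fun k => match k with inl i => T i | inr j => S j end).
split=> [[]//|v v' vv' [Xv Yv]]; split.
- by apply: XP Xv => i; apply: (vv' (inl i)).
- by apply: YP Yv => i; apply: (vv' (inr i)).
Qed.

Lemma sign_determined_atom n (c : 'I_n -> R) (T : set R) (P : R -> Prop) :
  small T ->
  (forall x x', (forall t, T t -> Num.sg (x + t) = Num.sg (x' + t)) -> P x -> P x') ->
  sign_determined (fun v => P (dot c v)).
Proof.
move=> sT PT; exists unit, (fun=> c), (fun=> T); split => // v v' vv'.
by apply: PT => t; apply: (vv' tt).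
Qed.

(** Fourier-Motzkin elimination. A form d y + e . v + t with d != 0 compares y
    with the value g v t = - (e . v + t) / d. The eliminated condition records
    the signs of the forms with d = 0 and of all differences g_j - g_i, whose
    constants are differences of scaled constants. If these signs agree at v
    and v', the values of g at v and at v' are arranged in the same order, so a
    witness y over v can be moved to a witness y' over v' in the same position:
    to the value with the same index if y is a value of some g, and otherwise
    strictly between the images of the values below y and of those above y. *)
Lemma sign_determined_ex n (X : ('I_n.+1 -> R) -> Prop) :
  sign_determined X -> sign_determined (fun v => exists y, X (push y v)).
Proof.
move=> [I [c [T [sT XP]]]].
pose d i := c i ord0; pose e i (k : 'I_n) := c i (lift ord0 k).
pose g v i t := - (d i)^-1 * (dot (e i) v + t).
pose e' (k : I + I * I) := match k with
  | inl i => e i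
  | inr (i, j) => fun k => (d i)^-1 * e i k - (d j)^-1 * e j k end.
pose T' (k : I + I * I) := match k with
  | inl i => T i
  | inr (i, j) => [set (d i)^-1 * t.1 + - (d j)^-1 * t.2 | t in T i `*` T j] end.
exists (I + I * I)%type, e', T'; split=> [[i|[i j]]//=|].
  exact: small_comb.
move=> v v' vv' [y Xy].
have gg i j t s : T i t -> T j s ->
    Num.sg (g v j s - g v i t) = Num.sg (g v' j s - g v' i t).
  move=> Tt Ts; have /= := vv' (inr (i, j)) ((d i)^-1 * t + - (d j)^-1 * s).
  rewrite !dotB !dotZ => H.
  have gE u : g u j s - g u i t = (d i)^-1 * dot (e i) u -
     (d j)^-1 * dot (e j) u + ((d i)^-1 * t + - (d j)^-1 * s).
    by rewrite /g; ring.
  by rewrite !gE H//; exists (t, s).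
have cE i u z t : d i != 0 -> dot (c i) (push z u) + t = d i * (z - g u i t).
  by move=> d0; rewrite dot_push /g -/(d i) -/(e i); field.
suff [y' yP] : exists y', forall i t, d i != 0 -> T i t ->
    Num.sg (y - g v i t) = Num.sg (y' - g v' i t).
  exists y'; apply: XP Xy => i t Tt.
  have [d0|d0] := eqVneq (d i) 0; last by rewrite !cE// !sgrM yP.
  by rewrite !dot_push -/(d i) d0 !mul0r !add0r; apply: (vv' (inl i)).
have [[i [t [d0 Tt yE]]]|hit] := pselect (exists i t, [/\ d i != 0, T i t & y = g v i t]).
  exists (g v' i t) => j s dj Ts; rewrite yE.
  exact: gg.
(* side false i and side true i are the constants whose values are below y and
   above y. They are closed although they are cut out by a strict condition,
   because no value equals y. *)
pose side (b : bool) i := [set t | T i t /\ ((-1) ^+ b * (y - g v i t) >= 0)].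
have cside b i : compact (side b i).
  apply: (@subclosed_compact _ _ (T i)) => [||t []//]; last exact: small_compact.
  apply: closedI; first by apply: compact_closed; [exact: Rhausdorff|exact: small_compact].
  apply: (@preimage_closed _ _ (fun t => (-1) ^+ b * (y - g v i t)) [set x | 0 <= x]);
    last exact: closed_ge.
  move=> x _ ; apply: cvgM; first exact: cvg_cst.
  apply: cvgB; first exact: cvg_cst.
  apply: cvgM; first exact: cvg_cst.
  by apply: cvgD; [exact: cvg_cst|exact: cvg_id].
pose D b := \big[setU/set0]_(i <- enum I | d i != 0) (g v' i @` side b i).
have cD b : compact (D b).
  apply: bigsetU_compact => i _; apply: continuous_compact => //.
  apply: continuous_subspaceT => x.
  by apply: cvgM; [exact: cvg_cst|apply: cvgD; [exact: cvg_cst|exact: cvg_id]].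
have DP b z : D b z <-> exists i, d i != 0 /\ exists2 t, side b i t & g v' i t = z.
  rewrite /D -bigcup_seq_cond; split.
    by move=> [i /= /andP[_ di] [t st tz]]; exists i; split => //; exists t.
  by move=> [i [di [t st tz]]]; exists i; [rewrite /= mem_enum|exists t].
have gneq i t : d i != 0 -> T i t -> y - g v i t != 0.
  move=> di Tt; rewrite subr_eq0; apply/eqP => yE; apply: hit.
  by exists i, t.
have [||l u|y' [y'L y'U]] := @separating_point (D false) (D true) => //.
  move=> /DP[i [di [t [Tt /=+] <-]]] /DP[j [dj [s [Ts /=+] <-]]].
  rewrite expr0 expr1 mul1r => yt ys.
  have := gneq _ _ di Tt; have := gneq _ _ dj Ts => neqs neqt.
  rewrite -subr_gt0 -sgr_gt0 -gg// sgr_gt0; lra.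
exists y' => i t di Tt; have neq := gneq _ _ di Tt.
have [lt0|gt0|eq0] := ltgtP (y - g v i t) 0; last by rewrite eq0 eqxx in neq.
  rewrite ltr0_sg// ltr0_sg// subr_lt0; apply: y'U.
  by apply/DP; exists i; split => //; exists t => //; split => //=; lra.
rewrite gtr0_sg// gtr0_sg// subr_gt0; apply: y'L.
by apply/DP; exists i; split => //; exists t => //; split => //=; lra.
Qed.

(** The atom A(x) says that x - a vanishes for some a in A, so its constants
    are the points of -A. *)
Lemma sign_determined_holds (A : set R) n
    (phi : formula (pred_language (vs_language R)) n) :
  small A -> sign_determined (holds (expand_pred (ordered_vs R) A) phi).
Proof.
move=> sA; elim: phi => {n} [n t u|n [[]|] args|n p|n p IHp q IHq|n p] /=.
- have [[c cE] [d dE]] := (eval_dot A t, eval_dot A u).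
  have -> : (fun v => Defs.eval (expand_pred (ordered_vs R) A) v t =
      Defs.eval (expand_pred (ordered_vs R) A) v u) =
      (fun v => dot (fun i => c i - d i) v = 0).
    apply/funext => v; rewrite cE dE dotB; apply/propext.
    by split=> [->|/eqP]; [rewrite subrr|rewrite subr_eq0 => /eqP].
  apply: (sign_determined_atom (P := fun x => x = 0) _ small0) => x x'.
  move=> /(_ 0 erefl); rewrite !addr0 => + x0; rewrite x0 sgr0 => /esym/eqP.
  by rewrite sgr_eq0 => /eqP.
- have [[c cE] [d dE]] := (eval_dot A (args ord0), eval_dot A (args ord_max)).
  have -> : (fun v => Defs.eval (expand_pred (ordered_vs R) A) v (args ord0) <
      Defs.eval (expand_pred (ordered_vs R) A) v (args ord_max)) =
      (fun v => dot (fun i => d i - c i) v > 0) :> (('I_n -> R) -> Prop).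
    by apply/funext => v; rewrite cE dE dotB subr_gt0.
  apply: (sign_determined_atom (P := fun x => x > 0) _ small0) => x x'.
  by move=> /(_ 0 erefl); rewrite !addr0 -sgr_gt0 => ->; rewrite sgr_gt0.
- have [c cE] := eval_dot A (args ord0).
  have -> : (fun v => A (Defs.eval (expand_pred (ordered_vs R) A) v (args ord0)))
      = (fun v => A (dot c v)) by apply/funext => v; rewrite cE.
  apply: (sign_determined_atom _ (small_comb (-1) 0 sA sA)) => x x' + Ax.
  move=> /(_ (- x)) H; have : Num.sg (x - x) = Num.sg (x' - x).
    by apply: H; exists (x, x) => //=; rewrite mulN1r mul0r addr0.
  by rewrite subrr sgr0 => /esym/eqP; rewrite sgr_eq0 subr_eq0 => /eqP ->.
- exact: sign_determined_not.
- exact: sign_determined_and.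
- exact: sign_determined_ex.
Qed.

End SignDetermined.

(** * A Cantor set with oscillating gaps *)

(** The witness is s n = n + f n with f n the least factorial above n. Just after
    a factorial j! the term f n = (j+1)! dominates n, and just before it
    f n = n + 1. *)
Lemma oscillating_exponents : exists s : nat -> nat,
  [/\ forall n, (s n < s n.+1)%N,
      forall p m, exists2 n, (m <= n)%N & (p * n <= s n)%N &
      forall m, exists2 n, (m <= n)%N & (s n <= 2 * n + 1)%N].
Proof.
have fact_mono i j : (i <= j)%N -> (i`! <= j`!)%N.
  elim: j => [|j IH]; first by rewrite leqn0 => /eqP ->.
  rewrite leq_eqVlt => /predU1P[->//|]; rewrite ltnS => /IH /leq_trans; apply.
  by rewrite factS leq_pmull.
have fact_ge j : (j <= j`!)%N.
  by case: j => // j; rewrite factS leq_pmulr// fact_gt0.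
have ex k : exists j, (k < j`!)%N by exists k.+1; apply: fact_ge.
pose nf k := ex_minn (ex k).
have nf_gt k : (k < (nf k)`!)%N by rewrite /nf; case: ex_minnP.
have nf_le k j : (k < j`!)%N -> (nf k <= j)%N.
  by move=> kj; rewrite /nf; case: ex_minnP => m _; apply.
exists (fun k => k + (nf k)`!)%N; split.
- move=> n; rewrite addSn ltnS leq_add2l fact_mono// nf_le//.
  by apply: leq_trans (nf_gt n.+1); rewrite ltnS leqnSn.
- move=> p m; pose j := maxn p m; exists j`!.
    by apply: leq_trans (fact_ge j); rewrite leq_maxr.
  apply: (@leq_trans (j.+1)`!).
    by rewrite factS leq_mul2r (leq_trans (leq_maxl p m)) ?orbT// leqnSn.
  apply: leq_trans (leq_addl _ _); apply: (fact_mono _ _ _).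
  rewrite ltnNge; apply/negP => /fact_mono; rewrite leqNgt => /negP; apply.
  exact: nf_gt.
- move=> m; have m1 := fact_ge m.+1.
  have nf_m : (nf (m.+1)`!.-1 <= m.+1)%N by apply: nf_le; rewrite prednK ?fact_gt0.
  exists (m.+1)`!.-1; first by lia.
  by have := fact_mono _ _ nf_m; lia.
Qed.

Section Cantor.
Local Open Scope ring_scope.
Variables (R : realType) (s : nat -> nat).
Hypothesis s_lt : forall n, (s n < s n.+1)%N.

Definition gap n : R := 4^-1 ^+ s n.

Lemma gap_gt0 n : 0 < gap n. Proof. by rewrite exprn_gt0. Qed.

Lemma gap_anti m n : (m <= s n)%N -> gap n <= 4^-1 ^+ m.
Proof. by move=> mn; apply: ler_wiXn2l => //; lra. Qed.

Lemma gapS n : 4 * gap n.+1 <= gap n.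
Proof.
have : gap n.+1 <= 4^-1 ^+ (s n).+1 by exact: gap_anti.
by rewrite exprS -/(gap n); lra.
Qed.

Lemma leq_s n : (n <= s n)%N.
Proof. by elim: n => // n IH; apply: leq_ltn_trans (s_lt n). Qed.

Definition left_end (w : seq bool) : R :=
  \sum_(k < size w) (nth false w k)%:R * gap k.

(** The bound 2 * gap n dominates the sum of all gaps from level n on, so
    cylinders decrease along extensions of words. A sum over an infinite word
    is then the common point of the cylinders of its prefixes. *)
Definition cylinder (w : seq bool) : set R :=
  [set y | left_end w <= y <= left_end w + 2 * gap (size w)].

Definition cantor_set : set R :=
  [set y | forall n, exists2 w, size w = n & cylinder w y].

Lemma left_end_rcons w b :
  left_end (rcons w b) = left_end w + b%:R * gap (size w).
Proof.
rewrite /left_end size_rcons big_ord_recr /= nth_rcons ltnn eqxx; congr (_ + _).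
by apply: eq_bigr => i _; rewrite nth_rcons ltn_ord.
Qed.

Lemma cylinder_rcons w b : cylinder (rcons w b) `<=` cylinder w.
Proof.
move=> y /=; rewrite /cylinder /= left_end_rcons size_rcons.
have := gapS (size w); have := gap_gt0 (size w); have := gap_gt0 (size w).+1.
by case: b => /=; lra.
Qed.

Lemma cylinder_cat w u : cylinder (w ++ u) `<=` cylinder w.
Proof.
elim/last_ind: u => [|u b IH]; first by rewrite cats0.
by rewrite -rcons_cat => y /cylinder_rcons /IH.
Qed.

Lemma cylinder_take n w : cylinder w `<=` cylinder (take n w).
Proof. by rewrite -{1}(cat_take_drop n w); exact: cylinder_cat. Qed.

Lemma cylinder_left_end w : cylinder w (left_end w).
Proof. by rewrite /cylinder /= lexx; have := gap_gt0 (size w); lra. Qed.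

(** At the first letter where the words differ the left ends are gap k apart,
    while the cylinder on the left has length 2 * gap k.+1 <= gap k / 2. *)
Lemma cylinder_separated n w w' y y' :
  size w = n.+1 -> size w' = n.+1 -> w != w' ->
  cylinder w y -> cylinder w' y' -> gap n / 2 <= `|y - y'|.
Proof.
elim: n w w' => [|n IH] w w'; case/lastP: w => // v b; case/lastP: w' => // v' b';
  rewrite !size_rcons => -[sv] [sv'] ww' yw yw'.
all: have [vv'|vv'] := eqVneq v v'; last first.
- by move: vv'; rewrite (size0nil sv) (size0nil sv').
- move: vv' ww' yw yw' => <- {v' sv'}; rewrite eqseq_rcons eqxx /=.
  rewrite /cylinder /= !left_end_rcons !size_rcons sv.
  have := gapS 0; have := gap_gt0 0; have := gap_gt0 1.
  by case: b b' => [] [] //= g1 g0 gS _ yw yw'; rewrite ler_normr; apply/orP; [left|right]; lra.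
- have := IH _ _ sv sv' vv' (cylinder_rcons yw) (cylinder_rcons yw').
  have := gapS n; have := gap_gt0 n.+1; lra.
- move: vv' ww' yw yw' => <- {v' sv'}; rewrite eqseq_rcons eqxx /=.
  rewrite /cylinder /= !left_end_rcons !size_rcons sv.
  have := gapS n.+1; have := gap_gt0 n.+1; have := gap_gt0 n.+2.
  by case: b b' => [] [] //= g1 g0 gS _ yw yw'; rewrite ler_normr; apply/orP; [left|right]; lra.
Qed.

(** The point is the supremum of the left ends, by completeness. This is the
    only way in which infinite sequences of letters are used. *)
Lemma cantor_set_branch (w : nat -> seq bool) :
  (forall i, exists2 u, u != [::] & w i.+1 = w i ++ u) ->
  exists2 y, cantor_set y & forall i, cylinder (w i) y.
Proof.
move=> wS.
have wD i j : exists u, w (i + j)%N = w i ++ u.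
  elim: j => [|j [u uE]]; first by exists [::]; rewrite addn0 cats0.
  have [u' _] := wS (i + j)%N; rewrite -addnS => ->; rewrite uE -catA.
  by exists (u ++ u').
have sz i : (i <= size (w i))%N.
  elim: i => // i IH; have [[|b u] // _ ->] := wS i.
  by rewrite size_cat /= addnS ltnS (leq_trans IH)// leq_addr.
have cyl i j : cylinder (w i) (left_end (w (i + j)%N)).
  have [u ->] := wD i j; apply: cylinder_cat (cylinder_left_end _).
have mono i j : left_end (w i) <= left_end (w (i + j)%N).
  by have /andP[] := cyl i j.
have ub i : ubound (range (left_end \o w)) (left_end (w i) + 2 * gap (size (w i))).
  move=> _ [j _ <-] /=; apply: le_trans (mono j i) _; rewrite addnC.
  by have /andP[] := cyl i j.
exists (sup (range (left_end \o w))) => [n|i].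
  exists (take n (w n)); first by rewrite size_takel.
  apply: cylinder_take; apply/andP; split.
    apply: ub_le_sup; last by exists n.
    by exists (left_end (w 0) + 2 * gap (size (w 0))); exact: ub.
  by apply: ge_sup => //; exists (left_end (w 0)), 0%N.
apply/andP; split.
  apply: ub_le_sup; last by exists i.
  by exists (left_end (w 0) + 2 * gap (size (w 0))); exact: ub.
by apply: ge_sup => //; exists (left_end (w 0)), 0%N.
Qed.

Lemma cantor_set_neq0 : cantor_set !=set0.
Proof.
have [|y Ay _] := @cantor_set_branch (nseq^~ false); last by exists y.
by move=> i; exists [:: false] => //; rewrite -addn1 nseqD.
Qed.

Lemma cantor_set_compact : compact cantor_set.
Proof.
apply: (@subclosed_compact _ _ `[0, 2 * gap 0]%classic); last 1 first.
- move=> y /(_ 0%N)[w /size0nil ->]; rewrite /cylinder /left_end /= big_ord0 add0r.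
  by rewrite in_itv.
- have -> : cantor_set =
      \bigcap_n \bigcup_(w in [set: n.-tuple bool]) cylinder (tval w).
    apply/seteqP; split=> y Ay n.
      by move=> _; have [w /eqP sw yw] := Ay n; exists (Tuple sw).
    by have [w _ yw] := Ay n I; exists w => //; exact: size_tuple.
  apply: closed_bigI => n _; apply: closed_bigcup => [|w _]; first exact: finite_finset.
  have -> : cylinder w = `[left_end w, left_end w + 2 * gap (size w)]%classic.
    by apply/seteqP; split=> y; rewrite /= in_itv.
  exact: interval_closed.
- exact: segment_compact.
Qed.

(** A compact set covered at every scale gap n by 2^(p n) balls, up to a
    constant in the radius: the cover has the same form for sums and multiples
    of such sets, with other values of C and p. *)
Definition thin (T : set R) : Prop := compact T /\
  exists C p, 0 <= C /\ forall n, exists l : seq R, (size l <= 2 ^ (p * n))%N /\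
    forall t, T t -> exists2 e, e \in l & `|t - e| <= C * gap n.

Lemma thin_cantor_set : thin cantor_set.
Proof.
split; first exact: cantor_set_compact.
exists 2, 1%N; split => // n.
exists [seq left_end (tval w) | w : n.-tuple bool]; split.
  by rewrite size_map -cardE card_tuple card_bool mul1n.
move=> t /(_ n)[w /eqP sw /= /andP[tw1 tw2]]; exists (left_end w).
  by apply/fintype.imageP; exists (Tuple sw).
by rewrite ger0_norm ?subr_ge0// lerBlDl -(eqP sw).
Qed.

Lemma thin_zero : thin [set 0].
Proof.
split; first exact: compact_set1.
exists 0, 0%N; split=> // n; exists [:: 0]; split => // t ->.
by exists 0; rewrite ?inE// subrr normr0 mul0r.
Qed.

Lemma thin_comb T T' l m : thin T -> thin T' ->
  thin [set l * t.1 + m * t.2 | t in T `*` T'].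
Proof.
move=> [cT [C [p [C0 CP]]]] [cT' [C' [p' [C'0 CP']]]]; split.
  apply: continuous_compact; last exact: compact_setX.
  apply: continuous_subspaceT => x; apply: cvgD; apply: cvgM;
    [exact: cvg_cst|exact: cvg_fst|exact: cvg_cst|exact: cvg_snd].
exists (`|l| * C + `|m| * C'), (p + p')%N; split; first by rewrite addr_ge0// mulr_ge0.
move=> n; have [k [sk kP]] := CP n; have [k' [sk' kP']] := CP' n.
exists [seq l * x + m * y | x <- k, y <- k']; split.
  by rewrite size_allpairs mulnDl expnD leq_mul.
move=> _ [[t t'] [/kP[e ek te] /kP'[e' ek' te']] <-] /=.
exists (l * e + m * e'); first by apply/allpairsP; exists (e, e').
have -> : l * t + m * t' - (l * e + m * e') = l * (t - e) + m * (t' - e') by ring.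
rewrite (le_trans (ler_normD _ _))// !normrM mulrDl -!mulrA lerD// ler_wpM2l//.
Qed.

(** Lebesgue measure is subadditive. *)
Lemma cover_length (x y r : R) (l : seq R) : 0 <= r ->
  (forall z, x < z < y -> exists2 e, e \in l & `|z - e| <= r) ->
  y - x <= (size l)%:R * (2 * r).
Proof.
move=> r0 H; have [yx|xy] := leP y x.
  by rewrite (@le_trans _ _ 0) ?subr_le0// mulr_ge0// mulr_ge0.
pose ball i := `[nth 0 l i - r, nth 0 l i + r]%classic : set R.
have : (lebesgue_measure (`]x, y[%classic : set R) <=
    \sum_(i < size l) lebesgue_measure (ball i))%E.
  apply: content_subadditive => [i _||z /=].
  - exact: measurable_itv.
  - exact: measurable_itv.
  rewrite in_itv /= => /H[e el]; rewrite ler_norml => ze.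
  rewrite -bigcup_mkord; exists (index e l); first by rewrite /= index_mem.
  by rewrite /ball /= in_itv /= nth_index//; lra.
rewrite lebesgue_measure_itv /= lte_fin xy -EFinB.
under eq_bigr => i _.
  rewrite /ball lebesgue_measure_itv /= lte_fin.
  have -> : (if nth 0 l i - r < nth 0 l i + r then
    ((nth 0 l i + r)%:E - (nth 0 l i - r)%:E)%E else 0%E) = (2 * r)%:E.
    by case: ltP => ?; rewrite -?EFinB; congr EFin; lra.
  over.
by rewrite sumEFin lee_fin sumr_const card_ord -[X in _ <= X -> _]mulr_natl.
Qed.

Hypothesis s_fast : forall p m, exists2 n, (m <= n)%N & (p * n <= s n)%N.

(** At a level n with s n >= (p + 1) n the total length of the covering balls
    is at most 2 C 2^(p n) 4^(-(p+1) n) <= 2 C 2^(-n). *)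
Lemma thin_no_interval T x y : thin T -> x < y -> exists2 z, x < z < y & ~ T z.
Proof.
move=> [_ [C [p [C0 CP]]]] xy; apply: contrapT => H.
have [n mn pn] := s_fast p.+1 (Num.bound (2 * C / (y - x))).
have [l [sl lP]] := CP n.
have yx : y - x <= (size l)%:R * (2 * (C * gap n)).
  apply: cover_length; first by rewrite mulr_ge0// ltW// gap_gt0.
  by move=> z zxy; apply: lP; apply: contrapT => nTz; apply: H; exists z.
have small : (size l)%:R * gap n <= 2^-1 ^+ n.
  have -> : 2^-1 ^+ n = (2 ^ (p * n))%:R * 2^-1 ^+ (p * n + n) :> R.
    by rewrite exprD mulrA natrX -exprMn divff// expr1n mul1r.
  apply: ler_pM => //; [exact/ltW/gap_gt0|by rewrite ler_nat|].
  apply: (le_trans (gap_anti pn)).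
  have -> : 4^-1 = 2^-1 ^+ 2 :> R by rewrite expr2; field.
  by rewrite -exprM; apply: ler_wiXn2l; [lra|lra|rewrite mulSn; lia].
have := upper_nthrootP mn; rewrite ltr_pdivrMr ?subr_gt0//.
apply/negP; rewrite -leNgt -ler_pdivlMl ?exprn_gt0// -exprVn.
apply: (le_trans yx).
have -> : (size l)%:R * (2 * (C * gap n)) = (size l)%:R * gap n * (2 * C) by ring.
by rewrite ler_wpM2r// mulr_ge0.
Qed.

Hypothesis s_slow : forall m, exists2 n, (m <= n)%N & (s n <= 2 * n + 1)%N.

(** Baire category for the Cantor set: if every cylinder had a subcylinder that
    misses F i, one could pass to such subcylinders for i = 0, 1, 2, and so on,
    and their common point would lie in no F i. *)
Lemma dense_in_cylinder (F : (set R)^nat) : cantor_set `<=` \bigcup_i F i ->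
  exists i w, forall u, exists2 y, F i y & cylinder (w ++ u) y.
Proof.
move=> AF; apply: contrapT => H.
have /choice[f fP] : forall iw : nat * seq bool, exists u,
    forall y, F iw.1 y -> ~ cylinder (iw.2 ++ u) y.
  move=> [i w] /=; apply: contrapT => H'; apply: H; exists i, w => u.
  apply: contrapT => H; apply: H'; exists u => y Fy wy; apply: H.
  by exists y.
pose W := fix W i := if i is j.+1 then W j ++ rcons (f (j, W j)) false else [::].
have [|y Ay Wy] := @cantor_set_branch W.
  by move=> i; exists (rcons (f (i, W i)) false) => //; case: (f _).
have [i _ Fiy] := AF _ Ay.
apply: (fP (i, W i) y) => //=.
by have := Wy i.+1; rewrite /= -rcons_cat => /cylinder_rcons.
Qed.

(** At a level n with s n <= 2 n + 1, one point of F is chosen in each of the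
    2^d cylinders of length n + 1 below w. Balls of radius gap n / 5 around
    them are disjoint, and their diameters are at least 2^(-8 d) as soon as
    n >= 2 * size w; the exponent 1/8 turns this into 2^(-d). *)
Lemma packing_sup_dense (F : set R) w (t delta : R) :
  (forall u, exists2 y, F y & cylinder (w ++ u) y) ->
  0 <= t <= 8^-1 -> 0 < delta -> (1 <= packing_sup t delta F)%E.
Proof.
move=> Fw /andP[t0 t8] d0.
have [n mn sn] := s_slow (2 * size w + Num.bound delta^-1)%N.
pose d := (n.+1 - size w)%N; pose r := gap n / 5.
have g0 := gap_gt0 n; have r0 : 0 < r by rewrite divr_gt0.
have rd : r <= delta.
  have : delta^-1 < 2 ^+ n by apply: upper_nthrootP; exact: leq_trans (leq_addl _ _) mn.
  rewrite -ltf_pV2 ?posrE ?invr_gt0 ?exprn_gt0// invrK -exprVn => /ltW; apply: le_trans.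
  have : gap n <= 2^-1 ^+ n.
    apply: le_trans (gap_anti (leq_s n)) _.
    by apply: lerXn2r; rewrite ?nnegrE; lra.
  by rewrite /r; lra.
have /choice[y yP] : forall u : d.-tuple bool, exists y, F y /\ cylinder (w ++ u) y.
  by move=> u; have [y] := Fw u; exists y.
have sz (u : d.-tuple bool) : size (w ++ u) = n.+1.
  by rewrite size_cat size_tuple subnKC// (leq_trans _ (leqW mn))//; lia.
have sep u u' z : `|y u - z| <= r -> `|y u' - z| <= r -> u = u'.
  move=> uz u'z; apply/eqP; apply: contraT => uu'.
  have : gap n / 2 <= `|y u - y u'|.
    apply: (cylinder_separated (sz u) (sz u') _ (yP u).2 (yP u').2).
    by rewrite eqseq_cat// eqxx.
  have -> : y u - y u' = (y u - z) - (y u' - z) by ring.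
  have := ler_normB (y u - z) (y u' - z); rewrite /r in uz u'z *; lra.
pose e u := (y u, r).
have einj : set_inj [set: d.-tuple bool] e.
  by move=> u u' _ _ [yy]; apply: (sep _ _ (y u)); rewrite -?yy subrr normr0 ltW.
have ballE (x : R) : closed_ball x r = [set z | `|x - z| <= r].
  exact: (@closed_ballE R R^o x r r0).
have xP : 1 <= 2 ^+ d * (2 * r) `^ t.
  have x1 : 2^-1 ^+ (8 * d) <= 2 * r.
    apply: (@le_trans _ _ (4^-1 * gap n)); last by rewrite /r; lra.
    rewrite -exprS; have -> : 4^-1 = 2^-1 ^+ 2 :> R by rewrite expr2; field.
    by rewrite -exprM; apply: ler_wiXn2l; [lra|lra|rewrite /d; lia].
  have r1 : 0 < 2 * r <= 1.
    rewrite mulr_gt0//=; have := gap_anti (leq0n (s n)); rewrite expr0 /r; lra.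
  rewrite -ler_pdivrMl ?exprn_gt0// mulr1 -exprVn.
  apply: (le_trans _ (ger_powR r1 t8)).
  apply: (@le_trans _ _ ((2^-1 ^+ (8 * d)) `^ 8^-1)); last first.
    by apply: ge0_ler_powR => //; rewrite nnegrE ?exprn_ge0// ltW//; case/andP: r1.
  rewrite mulnC exprM -[_ ^+ 8]powR_mulrn ?exprn_ge0// -powRrM divff ?pnatr_eq0//.
  by rewrite powRr1// exprn_ge0.
apply: le_ereal_sup_tmp; exists (\esum_(p in e @` [set: d.-tuple bool]) ((2 * p.2) `^ t)%:E).
  exists (e @` setT) => //; split.
  - by apply: finite_set_countable; apply: finite_image; exact: finite_finset.
  - by move=> _ [u _ <-] /=; have [] := yP u; rewrite r0 rd.
  - move=> _ _ [u _ <-] [u' _ <-] [z []]; rewrite /= !ballE /= => uz u'z.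
    by rewrite (sep u u' z).
rewrite esum_image// esum_fset; [|exact: finite_finset|by move=> *; rewrite lee_fin powR_ge0].
have -> : [set: d.-tuple bool] = [set` enum {: d.-tuple bool}].
  by apply/seteqP; split => // u _; rewrite /= mem_enum.
rewrite -fsbig_seq ?enum_uniq// sumEFin lee_fin /= big_const_seq iter_addr_0.
rewrite (eq_count (a2 := predT))// count_predT -cardE card_tuple card_bool.
by rewrite -[X in _ <= X]mulr_natl natrX.
Qed.

Lemma packing_sup_ge0 (F : set R) t delta : (0 <= packing_sup t delta F)%E.
Proof.
apply: ereal_sup_ubound; exists set0; last by rewrite esum_set0.
by split.
Qed.

Lemma packing_premeasure_ge0 (F : set R) t : (0 <= packing_premeasure t F)%E.
Proof. by apply: le_ereal_inf_tmp => _ [delta _ <-]; exact: packing_sup_ge0. Qed.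

(** In any countable cover some member is dense in a cylinder, and for exponents
    up to 1/8 it alone has premeasure at least 1. *)
Lemma packing_dim_ge : (8^-1%:E <= packing_dim cantor_set)%E.
Proof.
apply: le_ereal_inf_tmp => _ [t [t0 tA] <-]; rewrite lee_fin leNgt.
apply/negP => t8; suff : (1 <= packing_measure t cantor_set)%E.
  by rewrite tA lee_fin ler10.
apply: le_ereal_inf_tmp => _ [F AF <-].
have [i [w iw]] := dense_in_cylinder AF.
apply: (@le_trans _ _ (packing_premeasure t (F i))).
  apply: le_ereal_inf_tmp => _ [delta /= d0 <-].
  by apply: packing_sup_dense iw _ d0; rewrite t0 ltW.
apply: le_trans (nneseries_lim_ge i.+1 _) => [|n _ _]; last first.
  exact: packing_premeasure_ge0.
rewrite big_nat_recr//= leeDr// sume_ge0// => n _; exact: packing_premeasure_ge0.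
Qed.

(** Induction on a strict bound of the lengths: unless some word is empty, and
    then the only one, the words split according to their first letter, and
    removing it doubles each weight. *)
Lemma kraft (T : eqType) (q : seq T) (w : T -> seq bool) : uniq q ->
  (forall i j, i \in q -> j \in q -> prefix (w i) (w j) -> i = j) ->
  \sum_(i <- q) 2^-1 ^+ size (w i) <= 1 :> R.
Proof.
have [N qN] : exists N, forall i, i \in q -> (size (w i) < N)%N.
  by exists (\max_(i <- q) size (w i)).+1 => i iq; apply: leq_bigmax_seq i iq isT.
elim: N q w qN => [|N IH] q w qN uq wP.
  case: q qN {uq wP} => [_|i q /(_ i)]; first by rewrite big_nil.
  by rewrite mem_head => /(_ isT).
have [/hasP[i iq /eqP wi]|/hasPn w0] := boolP (has (fun i => w i == [::]) q).
  have -> : q = [:: i].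
    apply/perm_small_eq => //; apply: uniq_perm => // j; rewrite inE.
    by apply/idP/eqP => [jq|->//]; apply/esym/wP => //; rewrite wi prefix0s.
  by rewrite big_seq1 wi.
have half b : \sum_(i <- q | head false (w i) == b) 2^-1 ^+ size (w i) <= 2^-1 :> R.
  rewrite -big_filter; set q' := [seq i <- q | head false (w i) == b].
  have q'P i : i \in q' -> w i = b :: behead (w i) /\ i \in q.
    rewrite mem_filter => /andP[/eqP <- iq]; have := w0 i iq.
    by case: (w i) => // *.
  rewrite big_seq (eq_bigr (fun i => 2^-1 * 2^-1 ^+ size (behead (w i)))); last first.
    by move=> i /q'P[-> _] /=; rewrite exprS.
  rewrite -big_seq -mulr_sumr -[leRHS]mulr1 ler_wpM2l//; apply: IH.
  - by move=> i /q'P[wi /qN]; rewrite {1}wi.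
  - exact: filter_uniq.
  - move=> i j /q'P[wi iq] /q'P[wj jq] ij; apply: wP => //.
    by rewrite wi wj prefix_cons eqxx.
rewrite (bigID (fun i => head false (w i) == false)) /=.
have := half false; have := half true.
have -> : \sum_(i <- q | head false (w i) == true) 2^-1 ^+ size (w i) =
  \sum_(i <- q | head false (w i) != false) 2^-1 ^+ size (w i) :> R.
  by apply: eq_bigl => i; case: head.
lra.
Qed.

(** With n the least level such that 2 * 4^(-n) <= r, the cylinder of length n
    around y has diameter at most 2 * gap n <= r; minimality of n bounds r from
    above by a multiple of 4^(-n). *)
Lemma packing_ball (y r : R) : cantor_set y -> 0 < r <= 1 ->
  exists w, [/\ cylinder w y, cylinder w `<=` closed_ball y r &
    2 * r <= 16 * 4^-1 ^+ size w].
Proof.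
move=> Ay /andP[r0 r1].
have ex : exists n, 2 * 4^-1 ^+ n <= r.
  exists (Num.bound (2 / r)).
  have := upper_nthrootP (leqnn (Num.bound (2 / r))).
  move=> /ltW; rewrite ler_pdivrMr// mulrC -ler_pdivrMr ?exprn_gt0// -exprVn.
  apply: le_trans; rewrite ler_wpM2l//; apply: lerXn2r; rewrite ?nnegrE; lra.
case: (ex_minnP ex) => n nr nmin; have [w sw wy] := Ay n.
exists w; split => // [z wz|].
  rewrite (@closed_ballE R R^o _ _ r0) /closed_ball_ /= ler_norml.
  move: wy wz; rewrite /cylinder /= sw; have := gap_anti (leq_s n); lra.
rewrite sw; case: n nr nmin {sw} => [|n] nr nmin; first by rewrite expr0; lra.
have : r < 2 * 4^-1 ^+ n.
  by rewrite ltNge; apply/negP => /nmin; rewrite ltnn.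
by rewrite exprS; lra.
Qed.

(** Disjoint balls contain cylinders of incomparable words, to which the Kraft
    inequality applies. The square root of a diameter is at most four times the
    weight 2^(-n) of its word; the remaining exponent 1/4 produces the factor
    that tends to 0 with delta. *)
Lemma packing_sup_le (delta : R) : 0 < delta <= 1 ->
  (packing_sup (3 / 4) delta cantor_set <= (4 * (2 * delta) `^ 4^-1)%:E)%E.
Proof.
move=> /andP[d0 d1]; apply: ge_ereal_sup => _ [P [cP PA Pdisj] <-].
apply: ge_ereal_sup => _ [Q [finQ QP] <-].
have /choice[w wP] : forall p : R * R, exists w, Q p ->
    [/\ cylinder w p.1, cylinder w `<=` closed_ball p.1 p.2 &
      2 * p.2 <= 16 * 4^-1 ^+ size w].
  move=> p; have [/QP/PA[Ap /andP[p0 pd]]|nQ] := pselect (Q p); last by exists [::].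
  have [|w wP] := packing_ball Ap (r := p.2); first by rewrite p0 (le_trans pd).
  by exists w.
have termP p : Q p ->
    (2 * p.2) `^ (3 / 4) <= 4 * (2 * delta) `^ 4^-1 * 2^-1 ^+ size (w p).
  move=> Qp; have [_ _ pw] := wP p Qp; have [_ /andP[p0 pd]] := PA _ (QP _ Qp).
  have -> : 3 / 4 = 2^-1 + 4^-1 :> R by field.
  rewrite powRD; last by apply/implyP => _; lra.
  rewrite mulrAC ler_pM ?powR_ge0//; last first.
    by apply: ge0_ler_powR; rewrite ?nnegrE; lra.
  apply: (@le_trans _ _ ((16 * 4^-1 ^+ size (w p)) `^ 2^-1)).
    by apply: ge0_ler_powR; rewrite ?nnegrE ?mulr_ge0 ?exprn_ge0//; lra.
  have -> : 16 * 4^-1 ^+ size (w p) = (4 * 2^-1 ^+ size (w p)) `^ 2%:R :> R.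
    rewrite powR_mulrn ?mulr_ge0 ?exprn_ge0// exprMn -exprM mulnC exprM.
    by congr (_ * _ ^+ _); rewrite expr2; field.
  by rewrite -powRrM divff ?pnatr_eq0// powRr1// mulr_ge0// exprn_ge0.
rewrite fsbig_finite//= sumEFin lee_fin big_seq.
apply: le_trans (ler_sum _ _) _ => [p|].
  by rewrite in_fset_set// inE => /termP; exact.
rewrite -big_seq -mulr_sumr ler_piMr ?mulr_ge0 ?powR_ge0//.
apply: kraft => [|p q]; first exact: finmap.fset_uniq.
rewrite !in_fset_set// !inE => Qp Qq /prefixP[u wu].
apply: Pdisj; [exact: QP|exact: QP|].
have [_ pb _] := wP p Qp; have [qw qb _] := wP q Qq.
exists q.1; split; last exact: qb.
by apply: pb; move: qw; rewrite wu => /cylinder_cat.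
Qed.

Lemma packing_dim_le : (packing_dim cantor_set <= (3 / 4)%:E)%E.
Proof.
have pre0 : packing_premeasure (3 / 4) cantor_set = 0%E.
  apply/eqP; rewrite eq_le packing_premeasure_ge0 andbT.
  apply/lee_addgt0Pr => eps e0; rewrite add0e.
  pose x := Num.min eps 1 / 4; pose delta := x ^+ 4 / 2.
  have x0 : 0 < x by rewrite divr_gt0// lt_min e0 ltr01.
  have x1 : x <= 1.
    have : Num.min eps 1 <= 1 by rewrite ge_min lexx orbT.
    by rewrite /x; lra.
  have xe : 4 * x <= eps.
    have : Num.min eps 1 <= eps by rewrite ge_min lexx.
    by rewrite /x; lra.
  have d0 : 0 < delta by rewrite divr_gt0// exprn_gt0.
  apply: (@le_trans _ _ (packing_sup (3 / 4) delta cantor_set)).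
    by apply: ereal_inf_lbound; exists delta.
  apply: (le_trans (packing_sup_le _)).
    by rewrite d0 /=; have := exprn_ile1 4 (ltW x0) x1; rewrite /delta; lra.
  have -> : 2 * delta = x `^ 4%:R.
    by rewrite powR_mulrn ?ltW// /delta; field.
  by rewrite -powRrM divff ?pnatr_eq0// powRr1 ?lee_fin// ltW.
apply: ereal_inf_lbound; exists (3 / 4) => //; split; first lra.
apply/eqP; rewrite eq_le; apply/andP; split.
  apply: ereal_inf_lbound; exists (fun=> cantor_set).
    by move=> y Ay; exists 0%N.
  by rewrite eseries0.
apply: le_ereal_inf_tmp => _ [F _ <-]; apply: nneseries_ge0 => n _ _.
exact: packing_premeasure_ge0.
Qed.

End Cantor.

(** * Closed sets that contain no interval *)

Section NowhereDense.
Local Open Scope ring_scope.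
Variable R : realType.

Lemma nowhere_dense_of_no_interval (A : set R) : closed A ->
  (forall x y, x < y -> exists2 z, x < z < y & ~ A z) -> nowhere_dense A.
Proof.
move=> cA noA; rewrite /nowhere_dense -(closure_id A).1//.
apply/seteqP; split => // x /nbhs_ballP[e /= e0 xA].
have [|z zx nAz] := noA (x - e) (x + e); first lra.
by apply: nAz; apply: xA; rewrite /ball /= ltr_distlC; lra.
Qed.

(** An open interval with end points outside A is relatively closed in A, so its
    boundary in A is empty. *)
Lemma topological_dim0_of_no_interval (A : set R) : A !=set0 ->
  (forall x y, x < y -> exists2 z, x < z < y & ~ A z) -> topological_dim A 0.
Proof.
move=> [a Aa] noA; split; last by move=> /= A0; rewrite A0 in Aa.
move=> x U Ax oU Ux; have /nbhs_ballP[e /= e0 xU] : nbhs x U by exact: open_nbhs_nbhs.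
have [|p px nAp] := noA (x - e) x; first lra.
have [|q qx nAq] := noA x (x + e); first lra.
exists `]p, q[%classic; split.
- exact: interval_open.
- by rewrite /= in_itv /=; lra.
- move=> z [_ /=]; rewrite in_itv /= => zpq; apply: xU.
  by rewrite /ball /= ltr_distlC; lra.
- apply/seteqP; split => // z [[Az zO] znO] /=.
  have cO : closure (A `&` `]p, q[) `<=` `[p, q].
    rewrite [X in _ `<=` X](closure_id _).1; last by exact: interval_closed.
    by apply: closure_subset => y [_] /=; rewrite !in_itv /=; lra.
  have cnO : closure (A `\` `]p, q[) `<=` ~` `]p, q[.
    rewrite [X in _ `<=` X](closure_id _).1; last first.
      by apply: open_closedC; exact: interval_open.
    by apply: closure_subset => y [].
  have /= nzO := cnO _ znO. apply: nzO.
  have := cO _ zO; rewrite /= !in_itv /= => /andP[pz zq].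
  apply/andP; split; rewrite lt_neqAle ?pz ?zq andbT; apply/eqP => zE.
    by apply: nAp; rewrite zE.
  by apply: nAq; rewrite -zE.
Qed.

Lemma common_free_interval (I : eqType) (l : seq I) (D : I -> set R) (x y : R) :
  (forall i, closed (D i)) ->
  (forall i u v, u < v -> exists2 z, u < z < v & ~ D i z) -> x < y ->
  exists u v, [/\ x <= u, u < v, v <= y &
    forall i z, i \in l -> u < z < v -> ~ D i z].
Proof.
move=> cD noD; elim: l x y => [|i l IH] x y xy; first by exists x, y; split.
have [u [v [xu uv vy Dl]]] := IH _ _ xy.
have [z zuv nDz] := noD i _ _ uv.
have /nbhs_ballP[e /= e0 zD] : nbhs z (~` D i).
  by apply: open_nbhs_nbhs; split => //; apply: closed_openC.
exists (Num.max u (z - e)), (Num.min v (z + e)); split.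
- by rewrite le_max xu.
- by rewrite gt_max !lt_min; lra.
- by rewrite ge_min vy.
- move=> j w; rewrite inE gt_max lt_min => /predU1P[->|jl] /andP[/andP[w1 w2] /andP[w3 w4]].
    by apply: zD; rewrite /ball /= ltr_distlC; lra.
  by apply: Dl => //; rewrite w1.
Qed.

Variable small : set R -> Prop.
Hypothesis small_closed : forall T, small T -> closed T.
Hypothesis small_no_interval : forall T x y, small T -> x < y ->
  exists2 z, x < z < y & ~ T z.

(** The form c z + r + t changes its sign only at z = - (r + t) / c. These points
    form finitely many affine images D i of the sets T i, and off their union
    all signs are locally constant. *)
Lemma sign_determined_constant k (X : ('I_k.+1 -> R) -> Prop) (b : 'I_k -> R) x y :
  sign_determined small X -> x < y ->
  exists u v, [/\ x <= u, u < v, v <= y &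
    forall z z', u < z < v -> u < z' < v -> X (push z b) -> X (push z' b)].
Proof.
move=> [I [c [T [sT XP]]]] xy.
pose r i := dot (fun j => c i (lift ord0 j)) b.
pose D i := [set z | c i ord0 != 0 /\ T i (- (c i ord0 * z + r i))].
have [|i u v uv|u [v [xu uv vy uvD]]] := @common_free_interval I (enum I) D x y _ _ xy.
- move=> i; have [c0|c0] := eqVneq (c i ord0) 0.
    have -> : D i = set0 by apply/seteqP; split => z // [/=]; rewrite c0 eqxx.
    exact: closed0.
  have -> : D i = (fun z => - (c i ord0 * z + r i)) @^-1` T i.
    by apply/seteqP; split => z // -[].
  apply: preimage_closed; last exact: small_closed.
  move=> z _; apply: cvgN; apply: cvgD; last exact: cvg_cst.
  by apply: cvgM; [exact: cvg_cst|exact: cvg_id].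
- pose g z := - (c i ord0 * z + r i); pose h w := (- w - r i) / c i ord0.
  have [c0|c0|c0] := ltgtP (c i ord0) 0.
  + have [|w wuv nTw] := small_no_interval (x := g u) (y := g v) (sT i).
      by rewrite ltrN2 ltrD2r ltr_nM2l.
    exists (h w); last by move=> [_]; rewrite /h mulrC divfK ?lt_eqF// subrK opprK.
    by rewrite /h ltr_ndivlMr// ltr_ndivrMr//; move: wuv; rewrite /g; lra.
  + have [|w wuv nTw] := small_no_interval (x := g v) (y := g u) (sT i).
      by rewrite ltrN2 ltrD2r ltr_pM2l.
    exists (h w); last by move=> [_]; rewrite /h mulrC divfK ?gt_eqF// subrK opprK.
    by rewrite /h ltr_pdivlMr// ltr_pdivrMr//; move: wuv; rewrite /g; lra.
  + by exists ((u + v) / 2); [lra|move=> []; rewrite c0 eqxx].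
exists u, v; split => // z z' zuv z'uv; apply: XP => i t Tt.
rewrite !dot_push -/(r i); have [->|c0] := eqVneq (c i ord0) 0.
  by rewrite !mul0r.
pose rho := - (r i + t) / c i ord0.
have E w : c i ord0 * w + r i + t = c i ord0 * (w - rho) by rewrite /rho; field.
have rho_out : ~ (u < rho < v).
  move=> /(uvD i); rewrite mem_enum => /(_ isT); apply; split => //.
  by have -> : - (c i ord0 * rho + r i) = t by rewrite /rho; field.
rewrite !E !sgrM; congr (_ * _).
have [rv|vr] := leP v rho; first by rewrite !ltr0_sg//; lra.
have ru : rho <= u by rewrite leNgt; apply/negP => ur; apply: rho_out; lra.
by rewrite !gtr0_sg//; lra.
Qed.

End NowhereDense.

(** * A compact plane set that is not definable *)

Section Graph.
Local Open Scope ring_scope.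
Variable R : realType.
Variable q : nat -> R.
Hypothesis q01 : forall n, 0 <= q n <= 1.

(** The whole segment {0} x [0, 1] is included so that compactness needs no
    information on the limit points of q. *)
Definition graph_with_segment : set 'rV[R]_2 := [set v |
  v ord0 ord0 = 0 /\ 0 <= v ord0 ord_max <= 1 \/
  exists n, v ord0 ord0 = 2^-1 ^+ n /\ v ord0 ord_max = q n].

Lemma graph_with_segment_compact : compact graph_with_segment.
Proof.
have cc i : continuous (fun v : 'rV[R]_2 => v ord0 i) by exact: coord_continuous.
pose B := [set v : 'rV[R]_2 | forall i, `[0, 1]%classic (v ord0 i)].
apply: (@subclosed_compact _ _ B); last 1 first.
- move=> v vK i; rewrite /= in_itv /=; case: vK => [[v0 v1]|[n [v0 v1]]].
    by case: (unliftP ord0 i) => [j ->|->]; [rewrite (_ : lift _ _ = ord_max)//; apply/val_inj; rewrite (ord1 j)|rewrite v0; lra].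
  case: (unliftP ord0 i) => [j ->|->].
    by rewrite (_ : lift _ _ = ord_max) ?v1//; apply/val_inj; rewrite (ord1 j).
  by rewrite v0 exprn_ge0//= exprn_ile1//; lra.
(* K N keeps the points of index below N and replaces all others by a narrow
   closed rectangle. *)
- pose K N := (fun v : 'rV[R]_2 => v ord0 ord0) @^-1` `[0, 2^-1 ^+ N] `&`
      (fun v : 'rV[R]_2 => v ord0 ord_max) @^-1` `[0, 1] `|`
    \bigcup_(n in `I_N) ((fun v : 'rV[R]_2 => v ord0 ord0) @^-1` [set 2^-1 ^+ n] `&`
      (fun v : 'rV[R]_2 => v ord0 ord_max) @^-1` [set q n]).
  have -> : graph_with_segment = \bigcap_N K N.
    apply/seteqP; split=> v.
      move=> [[v0 v1]|[n [v0 v1]]] N _.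
        by left; rewrite /= !in_itv /= v0 lexx exprn_ge0.
      have [nN|Nn] := ltnP n N; first by right; exists n.
      by left; rewrite /= !in_itv /= v0 v1 exprn_ge0//= q01 ler_wiXn2l//; lra.
    move=> vK; have [|[n //]] := vK 0%N I.
    rewrite /= !in_itv /= expr0 => -[/andP[v0 _] v1].
    have [v00|v00] := eqVneq (v ord0 ord0) 0; first by left.
    have v_gt0 : 0 < v ord0 ord0 by rewrite lt_neqAle eq_sym v00.
    have [|[n _ [? ?]]] := vK (Num.bound (v ord0 ord0)^-1) I; last by right; exists n.
    rewrite /= !in_itv /= => -[/andP[_ +] _]; rewrite leNgt => /negP[].
    have := upper_nthrootP (leqnn (Num.bound (v ord0 ord0)^-1)).
    by rewrite exprVn invf_plt ?posrE ?exprn_gt0.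
  have closed_fib i (C : set R) : closed C -> closed ((fun v : 'rV[R]_2 => v ord0 i) @^-1` C).
    by move=> cC; apply: preimage_closed => // v _; exact: cc.
  have closed1 x : closed [set x : R].
    by apply: compact_closed; [exact: Rhausdorff|exact: compact_set1].
  apply: closed_bigI => N _; apply: closedU.
    by apply: closedI; apply: closed_fib; exact: interval_closed.
  apply: closed_bigcup => [|n _]; first exact: finite_II.
  by apply: closedI; apply: closed_fib; exact: closed1.
- exact: (@rV_compact R 2 (fun=> [set` `[0, 1]]) (fun=> @segment_compact _ _ _)).
Qed.

End Graph.

Section Avoidance.
Local Open Scope ring_scope.
Variable R : realType.

Definition rational_point (n : nat) : R :=
  if unpickle n is Some r then
    let x : R := ratr r in if 0 <= x <= 1 then x else 0
  else 0.

Lemma rational_point01 n : 0 <= rational_point n <= 1.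
Proof.
rewrite /rational_point; case: unpickle => [r|] /=; last by rewrite lexx ler01.
by case: ifP => //; rewrite lexx ler01.
Qed.

Lemma rational_point_dense x y : 0 <= x -> x < y -> y <= 1 ->
  exists n, x < rational_point n < y.
Proof.
move=> x0 xy y1; have [r] := rat_in_itvoo xy; rewrite in_itv /= => rxy.
by exists (pickle r); rewrite /rational_point pickleK /= ifT//; lra.
Qed.

Variable small : set R -> Prop.
Hypothesis small0 : small [set 0].
Hypothesis small_comb : forall T T' l m, small T -> small T' ->
  small [set l * t.1 + m * t.2 | t in T `*` T'].
Hypothesis small_compact : forall T, small T -> compact T.
Hypothesis small_no_interval : forall T x y, small T -> x < y ->
  exists2 z, x < z < y & ~ T z.

(** The points x such that (y, x) lies in the compact set for some y > 0 are the
    rationals of [0, 1]. If the set were definable, they would contain an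
    interval, which is not countable. *)
Lemma small_avoids_compact_set (A : set R) :
  small A -> avoids_compact_set (expand_pred (ordered_vs R) A).
Proof.
move=> sA; exists 2%N, (graph_with_segment rational_point); split.
  exact: graph_with_segment_compact rational_point01.
move=> [k [phi [b phiE]]].
pose b' j : R := b ord0 j; pose pt (y x : R) : 'rV[R]_2 :=
  \row_i (if i == ord0 then y else x).
have ptE y x : push y (push x b') = (fun i => row_mx (pt y x) b ord0 i).
  have push0 n a (v : 'I_n -> R) : push a v ord0 = a by rewrite /push unlift_none.
  have pushS n a (v : 'I_n -> R) i : push a v (lift ord0 i) = v i.
    by rewrite /push liftK.
  apply/funext => i; case: (@split_ordP 2 k i) => j ->; last first.
    rewrite row_mxEr.
    have -> : rshift 2 j = lift ord0 (lift ord0 j) by exact: val_inj.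
    by rewrite !pushS.
  rewrite row_mxEl mxE; case: (unliftP ord0 j) => [j' ->|->]; last first.
    have -> : lshift k (@ord0 1) = ord0 by exact: val_inj.
    by rewrite push0 eqxx.
  have -> : lshift k (lift ord0 j') = lift ord0 (@ord0 k).
    by apply: val_inj; rewrite (ord1 j').
  by rewrite pushS push0.
have sX := sign_determined_holds small0 small_comb small_compact phi sA.
have sP : sign_determined small (fun v : 'I_(2 + k) -> R => 0 < v ord0).
  have -> : (fun v : 'I_(2 + k) -> R => 0 < v ord0) =
      (fun v => 0 < dot (fun i => (i == ord0)%:R) v) :> (('I_(2 + k) -> R) -> Prop).
    apply/funext => v; rewrite /dot (bigD1 ord0)// mul1r big1 => [|i0 /negbTE ->].
      by rewrite /= addr0.
    by rewrite mul0r.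
  apply: (sign_determined_atom (P := fun x => 0 < x) _ small0) => x x'.
  by move=> /(_ 0 erefl); rewrite !addr0 -sgr_gt0 => ->; rewrite sgr_gt0.
have sY := sign_determined_ex small_comb small_compact (sign_determined_and sX sP).
have YE x : (exists y, holds (expand_pred (ordered_vs R) A) phi (push y (push x b')) /\
    0 < push y (push x b') ord0) <-> exists n, x = rational_point n.
  have push0 y : push y (push x b') ord0 = y by rewrite /push unlift_none.
  have pt0 y : pt y x ord0 ord0 = y by rewrite mxE eqxx.
  have pt1 y : pt y x ord0 ord_max = x by rewrite mxE.
  split=> [[y []]|[n xn]].
    rewrite push0 ptE => /phiE [[]|[n []]]; rewrite pt0 pt1.
      by move=> ->; rewrite ltxx.
    by move=> _ -> _; exists n.
  exists (2^-1 ^+ n); rewrite push0 exprn_gt0//; split => //.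
  by rewrite ptE; apply/phiE; right; exists n; rewrite pt0 pt1.
have small_closed T : small T -> closed T.
  by move=> sT; apply: compact_closed; [exact: Rhausdorff|exact: small_compact].
have [u [v [u0 uv v1 uvP]]] :=
  sign_determined_constant small_closed small_no_interval b' sY (@ltr01 R).
have [n nuv] := rational_point_dense u0 uv v1.
have : countable (`]u, v[%classic : set R).
  apply: (@sub_countable _ _ _ (range rational_point)).
    apply: subset_card_le => x /=; rewrite in_itv /= => xuv.
    have /YE[m ->] := uvP _ _ nuv xuv (proj2 (YE _) (ex_intro _ n erefl)).
    by exists m.
  exact: card_image_le.
move=> /countable_lebesgue_measure0; rewrite lebesgue_measure_itv /= lte_fin uv.
by rewrite -EFinB => -[] /eqP; rewrite subr_eq0 => /eqP vu; move: uv; rewrite vu ltxx.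
Qed.

End Avoidance.
Local Open Scope ereal_scope.

Theorem mainTheorem7 (R : realType) :
  exists A : set R,
    [/\ compact A,
        0 < packing_dim A < 1,
        nowhere_dense A,
        topological_dim A 0 &
        avoids_compact_set (expand_pred (ordered_vs R) A)].
Proof.
have [s [s_lt s_fast s_slow]] := oscillating_exponents.
have cA : compact (cantor_set (R := R) s) by exact: cantor_set_compact.
have thinA : thin s (cantor_set (R := R) s) by exact: thin_cantor_set.
have noI T x y : thin s T -> (x < y)%R -> exists2 z : R, (x < z < y)%R & ~ T z.
  exact: thin_no_interval.
exists (cantor_set s); split => //.
- apply/andP; split.
    apply: lt_le_trans (packing_dim_ge R s_lt s_slow).
    by rewrite lte_fin.
  apply: le_lt_trans (packing_dim_le R s_lt) _.
  by rewrite lte_fin; lra.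
- apply: nowhere_dense_of_no_interval => [|x y]; last exact: noI.
  by apply: compact_closed cA; exact: Rhausdorff.
- apply: topological_dim0_of_no_interval => [|x y]; last exact: noI.
  exact: cantor_set_neq0 s_lt.
- apply: (@small_avoids_compact_set R (thin s)) => //.
  + exact: thin_zero.
  + exact: thin_comb.
  + by move=> T [].
Qed.
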